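(* For an arbitrary rational function $\varphi\in \Bbbk(x,y)\setminus\Bbbk$, its annihilator $\mathcal{A}_{W_2}(\varphi)$ is a free submodule of rank $1$ of the $\Bbbk[x,y]$-module $W_2(\Bbbk)$. As a free generator of the submodule $\mathcal{A}_{W_2}(\varphi)$ one can choose the derivation $\delta_\varphi$.
   Context: $\Bbbk$ is an algebraically closed field of characteristic zero. $W_2=W_2(\Bbbk)$ is the Lie algebra of all $\Bbbk$-derivations of $\Bbbk[x,y]$, also regarded as a $\Bbbk[x,y]$-module; each $D\in W_2$ extends uniquely to a derivation of the field $\Bbbk(x,y)$. For $\varphi\in\Bbbk(x,y)\setminus\Bbbk$, the annihilator of $\varphi$ is $\mathcal{A}_{W_2}(\varphi)=\{D\in W_2 : D(\varphi)=0\}$. A generative rational function of $\varphi\in\Bbbk(x,y)\setminus\Bbbk$ is a generator (over $\Bbbk$) of the maximal subfield of $\Bbbk(x,y)$ of transcendence degree $1$ over $\Bbbk$ that contains $\varphi$ (it exists and is unique up to linear fractional transformations with coefficients in $\Bbbk$). ''Algebraically independent'' means algebraically independent over $\Bbbk$. Known facts making the following definition meaningful: if $\varphi$ has a generative function that is a polynomial, then it has one that is an irreducible polynomial; if $\varphi$ has no polynomial generative function, then it has a generative function of the form $p/q$ with $p,q\in\Bbbk[x,y]$ irreducible and algebraically independent. Definition of $\delta_\varphi$. (i) If $\varphi$ has a polynomial generative function, choose an irreducible polynomial $p\in\Bbbk[x,y]$ that is a generative function of $\varphi$, let $h=\gcd\left(\frac{\partial p}{\partial x},\frac{\partial p}{\partial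 y}\right)$, and put $$\delta_\varphi=\delta_p=\frac1h\left(-\frac{\partial p}{\partial y}\frac{\partial}{\partial x}+\frac{\partial p}{\partial x}\frac{\partial}{\partial y}\right).$$ (ii) If $\varphi$ has no polynomial generative function, choose irreducible algebraically independent polynomials $p,q\in\Bbbk[x,y]$ such that $p/q$ is a generative function of $\varphi$, let $P_0=p\frac{\partial q}{\partial y}-q\frac{\partial p}{\partial y}$, $Q_0=q\frac{\partial p}{\partial x}-p\frac{\partial q}{\partial x}$, $h=\gcd(P_0,Q_0)$, and put $$\delta_\varphi=\delta_{p,q}=\frac1h\left(P_0\frac{\partial}{\partial x}+Q_0\frac{\partial}{\partial y}\right).$$ The gcd's are defined up to a nonzero constant, so $\delta_p$ and $\delta_{p,q}$ are defined up to multiplication by a nonzero constant. *)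

(* Defs.v *)
From HB Require Import structures.
From mathcomp Require Import all_boot all_order all_algebra.
From mathcomp Require Import boolp.
From mathcomp Require Import mpoly.
From mathcomp Require Import ring.

Set Implicit Arguments.
Unset Strict Implicit.
Unset Printing Implicit Defensive.

Import GRing.Theory.
Local Open Scope ring_scope.

Section Modules.
Variables (R : comNzRingType) (M : lmodType R).

Definition is_submodule (N : M -> Prop) : Prop :=
  [/\ N 0,
      forall u v, N u -> N v -> N (u + v) &
      forall (a : R) u, N u -> N (a *: u)].

Definition is_basis (N : M -> Prop) (n : nat) (b : 'I_n -> M) : Prop :=
  (forall i, N (b i)) /\
  (forall v, N v -> exists! c : {ffun 'I_n -> R}, v = \sum_i c i *: b i).

Definition is_free_of_rank (N : M -> Prop) (n : nat) : Prop :=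
  exists b : 'I_n -> M, is_basis N b.

Definition is_free_generator (N : M -> Prop) (e : M) : Prop :=
  is_basis N (fun _ : 'I_1 => e).

End Modules.

Section Divisibility.
Variable R : idomainType.

Definition divides (a b : R) : Prop := exists c, b = c * a.

Definition is_gcd (a b h : R) : Prop :=
  [/\ divides h a, divides h b &
      forall d, divides d a -> divides d b -> divides d h].

Definition is_irreducible (p : R) : Prop :=
  [/\ p != 0, p \isn't a GRing.unit &
      forall a b, p = a * b ->
        a \is a GRing.unit \/ b \is a GRing.unit].

End Divisibility.

(* The k-algebra A is given by iota : k -> A because {fraction _} has no
   canonical algebra structure. *)
Section OverBase.
Variables (k : fieldType) (A : comNzRingType) (iota : {rmorphism k -> A}).

Definition alg_indep (n : nat) (b : 'I_n -> A) : Prop :=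
  forall P : {mpoly k[n]}, mmap iota b P = 0 -> P = 0.

Definition is_derivation (D : A -> A) : Prop :=
  [/\ forall u v, D (u + v) = D u + D v,
      forall c u, D (iota c * u) = iota c * D u &
      forall u v, D (u * v) = D u * v + u * D v].

End OverBase.

Section Subfields.
Variables (k K : fieldType) (iota : {rmorphism k -> K}).

Definition is_subfield (L : K -> Prop) : Prop :=
  [/\ forall c, L (iota c),
      forall u v, L u -> L v -> L (u - v),
      forall u v, L u -> L v -> L (u * v) &
      forall u, L u -> L u^-1].

(* k(S) *)
Definition adjoin (S : K -> Prop) (z : K) : Prop :=
  forall L, is_subfield L -> (forall s, S s -> L s) -> L z.

Definition algebraic_over (L : K -> Prop) (z : K) : Prop :=
  exists P : {poly K}, [/\ P != 0, forall i, L P`_i & root P z].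

Definition has_trdeg (L : K -> Prop) (n : nat) : Prop :=
  exists b : 'I_n -> K,
    [/\ forall i, L (b i),
        alg_indep iota b &
        forall z, L z -> algebraic_over (adjoin (fun s => exists i, s = b i)) z].

Definition trdeg1_containing (phi : K) (L : K -> Prop) : Prop :=
  [/\ is_subfield L, has_trdeg L 1 & L phi].

(* Maximal for inclusion; there is exactly one such subfield when phi is
   transcendental over k. *)
Definition maximal_trdeg1 (phi : K) (L : K -> Prop) : Prop :=
  trdeg1_containing phi L /\
  (forall L', trdeg1_containing phi L' ->
     (forall z, L z -> L' z) -> forall z, L' z -> L z).

(* L = k(g) for the maximal L *)
Definition is_generative (phi g : K) : Prop :=
  exists L, maximal_trdeg1 phi L /\ forall z, L z <-> adjoin (eq g) z.

End Subfields.

Notation kxy k := {mpoly k[2]}.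
Notation ratf k := {fraction {mpoly k[2]}}.

Definition polyK (k : fieldType) : {rmorphism k -> kxy k} := @mpolyC 2 k.
Definition ratK (k : fieldType) : {rmorphism k -> ratf k} :=
  @tofrac (kxy k) \o @mpolyC 2 k.

Definition is_const (k : fieldType) (phi : ratf k) : Prop :=
  exists c : k, phi = ratK k c.

Record W2 (k : fieldType) := MkW2 {
  der_fun :> kxy k -> kxy k;
  der_funP : is_derivation (polyK k) der_fun }.

Section W2Module.
Variable k : fieldType.
Local Notation A := (kxy k).
Implicit Types (D E : W2 k) (f g : A).

HB.instance Definition _ := gen_eqMixin (W2 k).
HB.instance Definition _ := gen_choiceMixin (W2 k).

Lemma W2_ext D E : (forall f, D f = E f) -> D = E.
Proof.
case: D E => [d dP] [e eP] /= /funext de; move: dP; rewrite de => dP.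
by congr MkW2; apply: Prop_irrelevance.
Qed.

Lemma W2_zeroP : is_derivation (polyK k) (fun=> 0).
Proof. by split=> *; rewrite ?(addr0, mulr0, mul0r). Qed.

Lemma W2_addP D E : is_derivation (polyK k) (fun f => D f + E f).
Proof.
case: (der_funP D) (der_funP E) => [Da Dc Dm] [Ea Ec Em]; split=> *.
- by rewrite Da Ea addrACA.
- by rewrite Dc Ec mulrDr.
- by rewrite Dm Em mulrDl mulrDr addrACA.
Qed.

Lemma W2_scaleP f D : is_derivation (polyK k) (fun g => f * D g).
Proof.
case: (der_funP D) => [Da Dc Dm]; split=> *.
- by rewrite Da mulrDr.
- by rewrite Dc mulrCA.
- by rewrite Dm mulrDr mulrA mulrCA.
Qed.

Definition W2_zero := MkW2 W2_zeroP.
Definition W2_add D E := MkW2 (W2_addP D E).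
Definition W2_scale f D := MkW2 (W2_scaleP f D).
Definition W2_opp D := W2_scale (-1) D.

Fact W2_addA : associative W2_add.
Proof. by move=> D E F; apply: W2_ext => f /=; rewrite addrA. Qed.
Fact W2_addC : commutative W2_add.
Proof. by move=> D E; apply: W2_ext => f /=; rewrite addrC. Qed.
Fact W2_add0 : left_id W2_zero W2_add.
Proof. by move=> D; apply: W2_ext => f /=; rewrite add0r. Qed.
Fact W2_addN : left_inverse W2_zero W2_opp W2_add.
Proof. by move=> D; apply: W2_ext => f /=; rewrite mulN1r addNr. Qed.

HB.instance Definition _ :=
  GRing.isZmodule.Build (W2 k) W2_addA W2_addC W2_add0 W2_addN.

Fact W2_scaleA f g D : W2_scale f (W2_scale g D) = W2_scale (f * g) D.
Proof. by apply: W2_ext => u /=; rewrite mulrA. Qed.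
Fact W2_scale1 : left_id 1 W2_scale.
Proof. by move=> D; apply: W2_ext => u /=; rewrite mul1r. Qed.
Fact W2_scaleDr : right_distributive W2_scale +%R.
Proof. by move=> f D E; apply: W2_ext => u /=; rewrite mulrDr. Qed.
Fact W2_scaleDl D : {morph W2_scale^~ D : f g / f + g}.
Proof. by move=> f g; apply: W2_ext => u /=; rewrite mulrDl. Qed.

HB.instance Definition _ := GRing.Zmodule_isLmodule.Build A (W2 k)
  W2_scaleA W2_scale1 W2_scaleDr W2_scaleDl.

Lemma W2_0E f : (0 : W2 k) f = 0. Proof. by []. Qed.
Lemma W2_DE D E f : (D + E) f = D f + E f. Proof. by []. Qed.
Lemma W2_ZE g D f : (g *: D) f = g * D f. Proof. by []. Qed.

Fact partialP (i : 'I_2) : is_derivation (polyK k) (mderiv i).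
Proof.
split=> [u v|c u|u v]; [exact: mderivD | by rewrite !mul_mpolyC mderivZ |].
exact: mderivM.
Qed.

Definition partial (i : 'I_2) : W2 k := MkW2 (partialP i).

End W2Module.

(* x is the variable of index 0, y the variable of index 1 *)
Notation ddx := (partial _ (0 : 'I_2)).
Notation ddy := (partial _ (1 : 'I_2)).

(* Quotient-rule identities, stated over an abstract field because [field]
   is very slow over {fraction _}. *)
Section QuotientRule.
Variables (F : fieldType) (a b c d a' b' c' d' : F).
Hypotheses (b0 : b != 0) (d0 : d != 0).

Lemma quotient_rule_wd : a * d = c * b -> a' * d + a * d' = c' * b + c * b' ->
  (a' * b - a * b') / b ^+ 2 = (c' * d - c * d') / d ^+ 2.
Proof.
move=> eac eac'.
have -> : a' = (c' * b + c * b' - a * d') / d by rewrite -eac' addrK mulfK.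
have -> : a = c * b / d by rewrite -eac mulfK.
by field; rewrite b0 d0.
Qed.

Lemma quotient_add : a / b + c / d = (a * d + c * b) / (b * d).
Proof. by field; rewrite b0 d0. Qed.

Lemma quotient_mul : a / b * (c / d) = (a * c) / (b * d).
Proof. by field; rewrite b0 d0. Qed.

Lemma quotient_rule_add :
  ((a' * d + a * d' + (c' * b + c * b')) * (b * d)
    - (a * d + c * b) * (b' * d + b * d')) / (b * d) ^+ 2
  = (a' * b - a * b') / b ^+ 2 + (c' * d - c * d') / d ^+ 2.
Proof. by field; rewrite b0 d0. Qed.

Lemma quotient_rule_mul :
  ((a' * c + a * c') * (b * d) - (a * c) * (b' * d + b * d')) / (b * d) ^+ 2
  = (a' * b - a * b') / b ^+ 2 * (c / d) + a / b * ((c' * d - c * d') / d ^+ 2).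
Proof. by field; rewrite b0 d0. Qed.

Lemma quotient_rule_cancel :
  a' - a / b * b' = (a' * b - a * b') / b ^+ 2 * b.
Proof. by field. Qed.

End QuotientRule.

Section Extension.
Variable k : fieldType.
Local Notation A := (kxy k).
Local Notation K := (ratf k).
Local Notation "f %:F" := (@tofrac A f).
Implicit Types (D : W2 k) (f g : A) (z w : K).

(* The extension of D to k(x,y), by the quotient rule on the representative
   chosen by [repr]: it does not depend on this choice ([W2_rat_quotient]), is
   a k-derivation extending D ([W2_ratP], [W2_rat_tofrac]), and is the only one
   ([W2_rat_unique]). *)
Definition W2_rat D z : K :=
  let a := \n_(repr z) in let b := \d_(repr z) in
  (D a * b - a * D b)%:F / b%:F ^+ 2.

Lemma ratf_repr z : z = (\n_(repr z))%:F / (\d_(repr z))%:F.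
Proof.
have d0 : (\d_(repr z))%:F != 0 by rewrite tofrac_eq0 denom_ratioP.
apply: (mulIf d0); rewrite mulfVK //.
elim/quotW: z {d0} => r; unlock tofrac.
rewrite !piE; apply/eqmodP; rewrite /= FracField.equivfE /FracField.mulf.
rewrite !numden_Ratio ?mulr1 ?oner_neq0 ?mulf_neq0 ?denom_ratioP //.
by rewrite FracField.equivf_r mulrC.
Qed.

Lemma W2_rat_quotient D f g : g != 0 ->
  W2_rat D (f%:F / g%:F) = (D f * g - f * D g)%:F / g%:F ^+ 2.
Proof.
move=> g0; rewrite /W2_rat; set z := f%:F / g%:F.
case: (der_funP D) => Da Dc Dm.
have gF : g%:F != 0 by rewrite tofrac_eq0.
have dF : (\d_(repr z))%:F != 0 by rewrite tofrac_eq0 denom_ratioP.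
have e : \n_(repr z) * g = f * \d_(repr z).
  apply/eqP; rewrite -tofrac_eq !tofracM; apply/eqP.
  have := ratf_repr z; rewrite {1}/z => ez.
  by rewrite -[f%:F](mulfVK gF) ez mulrAC mulfVK.
rewrite !tofracB !tofracM; refine (quotient_rule_wd dF gF _ _).
  by rewrite -!tofracM e.
by rewrite -!tofracM -!tofracD -!Dm e.
Qed.

Lemma ratfP z : exists a b, b != 0 /\ z = a%:F / b%:F.
Proof.
exists \n_(repr z), \d_(repr z); split; first exact: denom_ratioP.
exact: ratf_repr.
Qed.

Lemma W2_rat_tofrac D f : W2_rat D f%:F = (D f)%:F.
Proof.
have [_ _ Dm] := der_funP D.
have D1 : D 1 = 0.
  by have := Dm 1 1; rewrite !mulr1 mul1r => /(congr1 (+%R^~ (- D 1)));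
     rewrite subrr addrK.
have /(W2_rat_quotient D f) := oner_neq0 A.
by rewrite D1 mulr0 subr0 mulr1 tofrac1 expr1n !divr1.
Qed.

Lemma W2_ratP D : is_derivation (ratK k) (W2_rat D).
Proof.
have [Da Dc Dm] := der_funP D.
have DM u v : W2_rat D (u * v) = W2_rat D u * v + u * W2_rat D v.
  have [a [b [b0 ->]]] := ratfP u; have [c [d [d0 ->]]] := ratfP v.
  have bF : b%:F != 0 by rewrite tofrac_eq0.
  have dF : d%:F != 0 by rewrite tofrac_eq0.
  have -> : a%:F / b%:F * (c%:F / d%:F) = (a * c)%:F / (b * d)%:F.
    by rewrite !tofracM; refine (quotient_mul _ _ bF dF).
  have bd0 := mulf_neq0 b0 d0.
  rewrite (W2_rat_quotient D _ b0) (W2_rat_quotient D _ d0).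
  rewrite (W2_rat_quotient D _ bd0) !Dm.
  rewrite !(tofracB, tofracD, tofracM).
  refine (quotient_rule_mul _ _ _ _ _ _ bF dF).
split=> // [u v|c u].
  have [a [b [b0 ->]]] := ratfP u; have [c [d [d0 ->]]] := ratfP v.
  have bF : b%:F != 0 by rewrite tofrac_eq0.
  have dF : d%:F != 0 by rewrite tofrac_eq0.
  have -> : a%:F / b%:F + c%:F / d%:F = (a * d + c * b)%:F / (b * d)%:F.
    by rewrite tofracD !tofracM; refine (quotient_add _ _ bF dF).
  have bd0 := mulf_neq0 b0 d0.
  rewrite (W2_rat_quotient D _ b0) (W2_rat_quotient D _ d0).
  rewrite (W2_rat_quotient D _ bd0) !Da !Dm.
  rewrite !(tofracB, tofracD, tofracM).
  refine (quotient_rule_add _ _ _ _ _ _ bF dF).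
rewrite DM (_ : ratK k c = (polyK k c)%:F) // W2_rat_tofrac.
suff -> : D (polyK k c) = 0 by rewrite tofrac0 mul0r add0r.
have D1 : D 1 = 0.
  by have := Dm 1 1; rewrite !mulr1 mul1r => /(congr1 (+%R^~ (- D 1)));
     rewrite subrr addrK.
by have := Dc c 1; rewrite D1 mulr0 mulr1.
Qed.

Lemma W2_rat_unique D (E : K -> K) : is_derivation (ratK k) E ->
  (forall f, E f%:F = (D f)%:F) -> forall z, E z = W2_rat D z.
Proof.
move=> [_ _ EM] ED z; have [a [b [b0 ->]]] := ratfP z.
have bF : b%:F != 0 by rewrite tofrac_eq0.
have := EM (a%:F / b%:F) b%:F; rewrite mulfVK // !ED W2_rat_quotient // => e.
apply: (mulIf bF); rewrite -[LHS](addrK (a%:F / b%:F * (D b)%:F)) -e.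
by rewrite tofracB !tofracM; refine (quotient_rule_cancel _ _ _ bF).
Qed.

End Extension.

Definition annihilator (k : fieldType) (phi : ratf k) (D : W2 k) : Prop :=
  W2_rat D phi = 0.

Section Delta.
Variable k : fieldType.
Local Notation A := (kxy k).
Local Notation "f %:F" := (@tofrac A f).

Definition generative (phi g : ratf k) : Prop := is_generative (ratK k) phi g.

Definition has_poly_generative (phi : ratf k) : Prop :=
  exists p : A, generative phi p%:F.

Definition pair_fun (p q : A) : 'I_2 -> A := fun i => if i == 0 then p else q.

(* delta = (1/h) v is encoded by h *: delta = v: here h != 0 and W2 is
   torsion free. *)
Definition is_delta_poly (p : A) (delta : W2 k) : Prop :=
  exists2 h, is_gcd p^`M(0) p^`M(1) h &
    h *: delta = (- p^`M(1)) *: ddx + p^`M(0) *: ddy.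

Definition is_delta_frac (p q : A) (delta : W2 k) : Prop :=
  let P0 := p * q^`M(1) - q * p^`M(1) in
  let Q0 := q * p^`M(0) - p * q^`M(0) in
  exists2 h, is_gcd P0 Q0 h & h *: delta = P0 *: ddx + Q0 *: ddy.

(* delta_phi depends on the choices of p (or of p and q) and of h; [is_delta]
   holds of the derivations obtained from all admissible choices. *)
Definition is_delta (phi : ratf k) (delta : W2 k) : Prop :=
  (exists p : A,
     [/\ is_irreducible p, generative phi p%:F & is_delta_poly p delta])
  \/
  (~ has_poly_generative phi /\
   exists p q : A,
     [/\ is_irreducible p, is_irreducible q,
         alg_indep (polyK k) (pair_fun p q),
         generative phi (p%:F / q%:F) & is_delta_frac p q delta]).

End Delta.

(* Main.v *)
Require Import Defs.
From mathcomp Require Import all_boot all_order all_algebra.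
From mathcomp Require Import mpoly boolp ring.
Import Order.TTheory GRing.Theory.
Local Open Scope ring_scope.

Set Implicit Arguments.
Unset Strict Implicit.
Unset Printing Implicit Defensive.

Local Notation "f %:F" := (tofrac f).

(** Write phi = a/b with polynomials a, b, and let
    u_i = (d_i a) b - a (d_i b).  By the chain rule a derivation D kills phi
    exactly when D(x) u_0 + D(y) u_1 = 0, so the annihilator is the module of
    syzygies of the pair (u_0, u_1) ([annihilator_quotient]).  This pair is not
    (0, 0): in characteristic zero the vanishing of both partial derivatives of
    a/b makes it constant, as a comparison of leading monomials shows
    ([wronskian_eq0_proportional]).

    Syzygies of a nonzero pair over k[x,y] form a free module of rank 1
    ([syzygy_generator]).  Over a unique factorization domain this follows by
    dividing the pair by its gcd.  The proof given here gets the generator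
    without gcds, by minimality in k[x][y]: a nonzero syzygy of least degree in
    y generates all the others up to denominators c in k[x], by
    pseudo-division; if moreover its leading coefficient has least degree in x
    then the pair is divisible by no linear polynomial in x, and since k is
    algebraically closed the denominators can be cleared one linear factor at a
    time.

    Let e be the generator of the annihilator obtained in this way, and let
    delta satisfy h delta = P d/dx + Q d/dy, where h = gcd(P, Q) and the vector
    field (P, Q) kills a generative function g of phi.  A derivation that kills
    g kills the field k(g), to which phi belongs, so (P, Q) = t e for some t.
    Now t is a common divisor of P and Q, hence h = s t, hence e = s delta, and
    delta is a generator too ([primitive_free_generator]).  Finally (P, Q) is
    nonzero because its components are, up to order and sign, the numerators
    of the partial derivatives of g, which is not constant. *)

(** * Syzygies of two polynomials in k[x][y] *)

Lemma exists_minimal (T : Type) (P : T -> Prop) (mu : T -> nat) :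
  (exists x, P x) -> exists2 x, P x & forall y, P y -> (mu x <= mu y)%N.
Proof.
move=> [x Px].
have ex : exists n, `[< exists2 y, P y & mu y = n >].
  by exists (mu x); apply/asboolP; exists x.
case: (ex_minnP ex) => n /asboolP[y Py <-] min; exists y => // z Pz.
by apply: min; apply/asboolP; exists z.
Qed.

(** Evaluation at x = alpha acts on each coefficient in k[x] separately, so all
    the coefficients have the root alpha. *)
Lemma dvd_XsubC_coefs (k : fieldType) (alpha : k) (p : {poly {poly k}}) :
  map_poly (horner_eval alpha) p = 0 -> exists q, p = ('X - alpha%:P)%:P * q.
Proof.
move=> p0.
have root_coef i : root p`_i alpha.
  move/(congr1 (fun q : {poly k} => q`_i)): p0.
  by rewrite coef_map coef0 => /eqP.
exists (\poly_(i < size p) (p`_i %/ ('X - alpha%:P))).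
apply/polyP=> i; rewrite coefCM coef_poly.
case: ltnP => [_|le]; last by rewrite nth_default ?mulr0.
have /factor_theorem[q ->] := root_coef i.
by rewrite mulpK ?polyXsubC_eq0 // mulrC.
Qed.

Section Syzygies.
Variable k : closedFieldType.
Local Notation B := {poly {poly k}}.

(** When v is nonzero a syzygy (f, g) is determined by f, so the degree in y of
    the pair is measured on f alone. *)
Lemma syzygy_generator_right (u v : B) : v != 0 ->
  exists f0 g0 : B, f0 * u + g0 * v = 0 /\
    forall f g, f * u + g * v = 0 -> exists t, f = t * f0 /\ g = t * g0.
Proof.
move=> v0.
pose syz (w : B * B) := w.1 != 0 /\ w.1 * u + w.2 * v = 0.
have ex : exists w, syz w.
  by exists (v, - u); split=> //=; rewrite mulrC mulNr subrr.
have [w1 syz1 min_y] := exists_minimal (fun w : B * B => size w.1) ex.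
(* Among the syzygies of least degree in y, one whose leading coefficient
   has least degree in x. *)
pose syz_min (w : B * B) := syz w /\ (size w.1 <= size w1.1)%N.
have [] := @exists_minimal _ syz_min (fun w => size (lead_coef w.1)).
  by exists w1.
move=> [f0 g0] [[/= f0n0 syz0] le_y] min_x.
have {}min_y f g : f * u + g * v = 0 -> (size f < size f0)%N -> f = 0.
  move=> e lt; apply/eqP; apply: contraTT lt => fn0; rewrite -leqNgt.
  by apply: leq_trans le_y _; apply: (min_y (f, g)).
exists f0, g0; split=> // f g syzfg.
(* The remainder of the pseudo-division by f0 is the first entry of a syzygy,
   so it vanishes. *)
have [c [t [cn0 ef eg]]] :
    exists c t, [/\ c != 0, c%:P * f = t * f0 & c%:P * g = t * g0].
  pose c := lead_coef f0 ^+ scalp f f0; pose t := f %/ f0.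
  have ef : c%:P * f - t * f0 = f %% f0.
    by rewrite mul_polyC Pdiv.Idomain.divp_eq addrC addKr.
  have syzr : (c%:P * f - t * f0) * u + (c%:P * g - t * g0) * v = 0.
    have -> : (c%:P * f - t * f0) * u + (c%:P * g - t * g0) * v
      = c%:P * (f * u + g * v) - t * (f0 * u + g0 * v).
      by rewrite !mulrBl !mulrDr !mulrA opprD addrACA.
    by rewrite syzfg syz0 !mulr0 subrr.
  have r0 : c%:P * f - t * f0 = 0.
    by apply: (min_y _ _ syzr); rewrite ef Pdiv.Idomain.ltn_modpN0.
  exists c, t; split; first by rewrite expf_neq0 ?lead_coef_eq0.
    by apply/eqP; rewrite -subr_eq0 r0.
  move: syzr; rewrite r0 mul0r add0r => /eqP.
  by rewrite mulf_eq0 (negPf v0) orbF subr_eq0 => /eqP.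
(* The denominator c is removed by induction on its degree. *)
have [n] := ubnP (size c); elim: n c t cn0 ef eg => // n IH c t cn0 ef eg le_n.
have [/closed_rootP[alpha /factor_theorem[c' ec]]|] := boolP (size c != 1%N).
  have a0 : ('X - alpha%:P : {poly k})%:P != 0 :> B.
    by rewrite polyC_eq0 polyXsubC_eq0.
  have c'n0 : c' != 0 by apply: contraNneq cn0 => c'0; rewrite ec c'0 mul0r.
  have lt_n : (size c' < n)%N.
    by move: le_n; rewrite ec size_Mmonic ?monicXsubC // size_XsubC addn2.
  pose at_alpha : B -> {poly k} := map_poly (horner_eval alpha).
  have vanish p q : c%:P * p = t * q -> at_alpha t = 0 \/ at_alpha q = 0.
    move=> /(congr1 at_alpha); rewrite /at_alpha !rmorphM /= map_polyC /=.
    rewrite {1}/horner_eval ec !hornerE subrr !mulr0 mul0r => /esym/eqP.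
    by rewrite mulf_eq0 => /orP[]/eqP; [left|right].
  (* If t does not vanish on the line x = alpha then f0 and g0 both do, and
     dividing them by x - alpha contradicts the choice of f0. *)
  have [t0|t0] := pselect (at_alpha t = 0).
    have [t' et] := dvd_XsubC_coefs t0.
    apply: (IH c' t') => //; apply: (mulfI a0); rewrite !mulrA -et -polyCM.
      by rewrite [_ * c']mulrC -ec.
    by rewrite [_ * c']mulrC -ec.
  have [//|/dvd_XsubC_coefs[f1 ef0]] := vanish _ _ ef.
  have [//|/dvd_XsubC_coefs[g1 eg0]] := vanish _ _ eg.
  have f1n0 : f1 != 0 by apply: contraNneq f0n0 => f10; rewrite ef0 f10 mulr0.
  have syz1' : f1 * u + g1 * v = 0.
    by apply: (mulfI a0); rewrite mulr0 mulrDr !mulrA -ef0 -eg0.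
  have : (size (lead_coef f0) <= size (lead_coef f1))%N.
    apply: (min_x (f1, g1)); split=> //=.
    rewrite (leq_trans _ le_y) // ef0 mul_polyC size_scale //.
    by rewrite polyXsubC_eq0.
  rewrite ef0 lead_coefM lead_coefC mulrC.
  by rewrite size_Mmonic ?monicXsubC ?lead_coef_eq0 // size_XsubC addn2 ltnn.
rewrite negbK => /size_poly1P[a an0 ea].
have cK : (a^-1)%:P%:P * c%:P = 1 :> B by rewrite ea -!polyCM mulVf.
exists ((a^-1)%:P%:P * t).
by rewrite -!mulrA -ef -eg !mulrA cK !mul1r.
Qed.

Lemma syzygy_generator (u v : B) : u != 0 \/ v != 0 ->
  exists f0 g0 : B, f0 * u + g0 * v = 0 /\
    forall f g, f * u + g * v = 0 -> exists t, f = t * f0 /\ g = t * g0.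
Proof.
case=> [u0|]; last exact: syzygy_generator_right.
have [g0 [f0 [e gen]]] := syzygy_generator_right v u0.
exists f0, g0; split=> [|f g efg]; first by rewrite addrC.
by have [|t [-> ->]] := gen g f; [rewrite addrC | exists t].
Qed.

End Syzygies.

(** * Transport to polynomials in two variables *)

Lemma mpoly_ring_ind (n : nat) (R : comNzRingType) (P : {mpoly R[n]} -> Prop) :
  (forall c, P c%:MP) -> (forall i, P 'X_i) ->
  (forall p q, P p -> P q -> P (p + q)) ->
  (forall p q, P p -> P q -> P (p * q)) -> forall p, P p.
Proof.
move=> PC PX PD PM.
have PXm m : P 'X_[m].
  rewrite mpolyXE_id; apply: big_ind => //; first exact: (PC 1).
  move=> i _; elim: (m i) => [|d IHd]; first exact: (PC 1).
  by rewrite exprS; apply: PM.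
elim/mpolyind=> [|c m p _ _ Pp]; first by rewrite -mpolyC0.
by apply: PD => //; rewrite -mul_mpolyC; apply: PM.
Qed.

(** The variable x becomes the inner variable of k[x][y] and y the outer one; G
    substitutes x and y back.  Syzygies of (u, v) are mapped by F to syzygies of
    (F u, F v) and come back through G. *)
Lemma kxy_retract_poly2 (k : fieldType) :
  exists (F : {rmorphism kxy k -> {poly {poly k}}})
         (G : {rmorphism {poly {poly k}} -> kxy k}), cancel F G.
Proof.
pose F : {rmorphism kxy k -> {poly {poly k}}} :=
  mmap (polyC \o polyC) (fun i : 'I_2 => if i == 0 then 'X%:P else 'X).
pose G1 : {rmorphism {poly k} -> kxy k} :=
  horner_morph (fun c : k => mulrC 'X_0 (@mpolyC 2 k c)).
pose G : {rmorphism {poly {poly k}} -> kxy k} :=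
  horner_morph (fun c : {poly k} => mulrC 'X_1 (G1 c)).
exists F, G; apply: mpoly_ring_ind => [c|i|p q Ep Eq|p q Ep Eq].
- by rewrite /F /= mmapC /= /G horner_morphC /G1 /= horner_morphC.
- rewrite /F /= mmapX mmap1U; case: eqP => [->|ni].
    by rewrite /G /= horner_morphC /G1 /= horner_morphX.
  rewrite /G /= horner_morphX; congr 'X_ _; apply/val_inj => /=.
  by case: i ni => [[|[|m]] lt_m] // []; apply: val_inj.
- by rewrite !rmorphD Ep Eq.
- by rewrite !rmorphM Ep Eq.
Qed.

Lemma kxy_syzygy_generator (k : closedFieldType) (u v : kxy k) :
  u != 0 \/ v != 0 ->
  exists f0 g0 : kxy k, f0 * u + g0 * v = 0 /\
    forall f g, f * u + g * v = 0 -> exists t, f = t * f0 /\ g = t * g0.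
Proof.
move=> uv0; have [F [G FK]] := kxy_retract_poly2 k.
have Fn0 w : w != 0 -> F w != 0.
  by apply: contra_neq => /(congr1 G); rewrite FK rmorph0.
have [|f0 [g0 [e gen]]] := @syzygy_generator k (F u) (F v).
  by case: uv0 => /Fn0; [left|right].
exists (G f0), (G g0); split=> [|f g efg].
  by move/(congr1 G): e; rewrite rmorph0 rmorphD !rmorphM !FK.
have [|t [ef eg]] := gen (F f) (F g).
  by rewrite -!rmorphM -rmorphD efg rmorph0.
by exists (G t); rewrite -!rmorphM -ef -eg !FK.
Qed.

(** * Polynomials with proportional partial derivatives *)

(** The Euler operator x_i d/dx_i acts diagonally on monomials; unlike d/dx_i
    alone it keeps leading monomials in place. *)
Lemma mcoeff_euler (n : nat) (R : comNzRingType) (i : 'I_n)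
    (p : {mpoly R[n]}) m :
  ('X_i * p^`M(i))@_m = p@_m *+ m i.
Proof.
elim/mpolyind: p => [|c m' p _ _ IHp].
  by rewrite mderiv0 mulr0 mcoeff0 mul0rn.
rewrite mderivD mulrDr !mcoeffD IHp mulrnDl; congr (_ + _).
rewrite mderivZ mderivX -!scalerAr !mcoeffZ mcoeffX.
have [m'0|m'i] := posnP (m' i).
  rewrite m'0 mul0r mulr0.
  by case: eqP => [<-|_]; rewrite ?m'0 ?mulr0n ?mulr0 ?mul0rn.
rewrite -mpolyXD addmC submK; last first.
  by apply/mnm_lepP => l; rewrite mnm1E; case: eqP => // <-.
rewrite mcoeffX; case: eqP => [<-|_]; last by rewrite !mulr0 mul0rn.
by rewrite !mulr1 mulr_natr.
Qed.

(** Subtracting a multiple of b from a, the coefficient of a at the leading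
    monomial of b may be taken to be 0.  If the difference d were nonzero, the
    leading coefficients of (x_i d_i d) b = d (x_i d_i b) would force the
    exponents of the leading monomials of d and b to agree in k, hence in nat
    by characteristic zero: a contradiction. *)
Lemma wronskian_eq0_proportional (n : nat) (k : fieldType)
    (char0 : [pchar k] =i pred0) (a b : {mpoly k[n]}) : b != 0 ->
  (forall i, a^`M(i) * b = a * b^`M(i)) -> exists c, a = c *: b.
Proof.
move=> b0 W.
pose c := a@_(mlead b) / mleadc b; exists c.
pose d := a - c *: b.
have Wd i : d^`M(i) * b = d * b^`M(i).
  by rewrite mderivB mderivZ !mulrBl W -!scalerAl mulrC [_ * b]mulrC.
have db0 : d@_(mlead b) = 0.
  by rewrite mcoeffB mcoeffZ divfK ?subrr // mleadc_eq0.
apply/eqP; rewrite -subr_eq0; apply/eqP; rewrite -/d.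
apply: contra_eq db0 => d0.
have mlead_euler (p : {mpoly k[n]}) i : (mlead ('X_i * p^`M(i)) <= mlead p)%O.
  have [->|q0] := eqVneq ('X_i * p^`M(i)) 0; first by rewrite mlead0 le0x.
  apply: msupp_le_mlead; have := mlead_supp q0.
  rewrite !mcoeff_msupp mcoeff_euler.
  by apply: contra => /eqP ->; rewrite mul0rn.
suff -> : mlead b = mlead d by rewrite mleadc_eq0.
apply/mnmP => i.
have := congr1 (fun p => ('X_i * p)@_(mlead d + mlead b)) (Wd i).
rewrite /= [in LHS]mulrA [in RHS]mulrCA !mleadcMW ?mlead_euler // !mcoeff_euler.
rewrite mulrnAl mulrnAr => /eqP.
set x := (X in X *+ _ == _).
have x0 : x != 0 by rewrite mulf_neq0 ?mleadc_eq0.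
rewrite -mulr_natr -[x *+ _]mulr_natr => /eqP/(mulfI x0) e.
have nat0 := (pcharf0P k).1 char0.
case: (leqP (mlead d i) (mlead b i)) => [le|/ltnW le]; apply/eqP;
  rewrite eqn_leq le ?andbT /=.
  by rewrite -subn_eq0 -nat0 natrB // e subrr.
by rewrite -subn_eq0 -nat0 natrB // e subrr.
Qed.

(** * Derivations of k[x,y] and annihilators *)

Lemma ord2_eq (i : 'I_2) : i = 0 \/ i = 1.
Proof. by case: i => [[|[|m]] lt_m] //; [left|right]; apply: val_inj. Qed.

Lemma mderiv_var (n : nat) (R : nzRingType) (i j : 'I_n) :
  ('X_j : {mpoly R[n]})^`M(i) = (j == i)%:R.
Proof.
rewrite mderivX mnm1E; case: eqP => [->|_]; last by rewrite scale0r.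
by rewrite scale1r -{1}[U_(i)%MM]add0m addmK mpolyX0.
Qed.

Section Derivations.
Variable k : fieldType.
Local Notation A := (kxy k).
Implicit Types (D E e : W2 k) (a b f g : A) (phi z : ratf k).

Lemma W2_const D c : D c%:MP = 0.
Proof.
have [_ DZ DM] := der_funP D.
have D1 : D 1 = 0.
  by apply: (addrI (D 1)); rewrite addr0 -{3}[1]mulr1 DM mulr1 mul1r.
by have := DZ c 1; rewrite D1 mulr0 mulr1.
Qed.

Lemma W2_chain D f : D f = D 'X_0 * f^`M(0) + D 'X_1 * f^`M(1).
Proof.
have [DD _ DM] := der_funP D.
elim/mpoly_ring_ind: f => [c|i|p q Ep Eq|p q Ep Eq].
- by rewrite W2_const !mderivC !mulr0 addr0.
- rewrite !mderiv_var.
  have [->|->] := ord2_eq i.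
  + by rewrite mulr1 mulr0 addr0.
  + by rewrite mulr1 mulr0 add0r.
- by rewrite DD Ep Eq !mderivD !mulrDr addrACA.
- by rewrite DM Ep Eq !mderivM; ring.
Qed.

Lemma W2_eq D E : D 'X_0 = E 'X_0 -> D 'X_1 = E 'X_1 -> D = E.
Proof.
by move=> e0 e1; apply: W2_ext => f; rewrite W2_chain e0 e1 -W2_chain.
Qed.

Definition vfield f g : W2 k := f *: ddx + g *: ddy.

Lemma vfieldE f g p : vfield f g p = f * p^`M(0) + g * p^`M(1).
Proof. by []. Qed.

Lemma vfieldX0 f g : vfield f g 'X_0 = f.
Proof. by rewrite vfieldE !mderiv_var mulr1 mulr0 addr0. Qed.

Lemma vfieldX1 f g : vfield f g 'X_1 = g.
Proof. by rewrite vfieldE !mderiv_var mulr1 mulr0 add0r. Qed.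

Lemma W2_torsion_free f D : f *: D = 0 -> f != 0 -> D = 0.
Proof.
move=> fD0 f0; apply: W2_ext => p.
have /eqP : (f *: D) p = 0 by rewrite fD0.
by rewrite W2_ZE mulf_eq0 (negPf f0) => /eqP.
Qed.

Lemma W2_scalefI f D E : f != 0 -> f *: D = f *: E -> D = E.
Proof.
move=> f0 e; apply/eqP; rewrite -subr_eq0; apply/eqP.
by apply: (W2_torsion_free _ f0); rewrite scalerBr e subrr.
Qed.

Lemma W2_free_generator (N : W2 k -> Prop) e : e <> 0 -> N e ->
  (forall D, N D -> exists t, D = t *: e) -> is_free_generator N e.
Proof.
move=> e0 Ne gen; split=> // D /gen[t ->].
exists [ffun=> t]; split=> [|c]; first by rewrite big_ord1 ffunE.
rewrite big_ord1 => ec; apply/ffunP => i; rewrite ffunE ord1.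
apply/eqP; rewrite -subr_eq0; apply/negPn/negP => tc0; apply: e0.
by apply: (W2_torsion_free _ tc0); rewrite scalerBl ec subrr.
Qed.

Lemma annihilator_submodule phi : is_submodule (annihilator phi).
Proof.
have [a [b [b0 ->]]] := ratfP phi; rewrite /annihilator.
split=> [|D E|f D]; rewrite !W2_rat_quotient //.
- by rewrite !W2_0E mul0r mulr0 subrr tofrac0 mul0r.
- move=> eD eE; rewrite !W2_DE mulrDl mulrDr opprD addrACA tofracD mulrDl.
  by rewrite eD eE addr0.
- move=> eD; rewrite !W2_ZE -mulrA [a * _]mulrCA -mulrBr tofracM -mulrA.
  by rewrite eD mulr0.
Qed.

Lemma W2_rat_ker_subfield D : is_subfield (ratK k) (fun z => annihilator z D).
Proof.
have [RD RZ RM] := W2_ratP D; rewrite /annihilator.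
have R1 : W2_rat D 1 = 0.
  by rewrite -(tofrac1 A) W2_rat_tofrac -mpolyC1 W2_const tofrac0.
have RN u : W2_rat D (- u) = - W2_rat D u.
  by rewrite -mulN1r -(rmorph1 (ratK k)) -rmorphN RZ rmorphN rmorph1 mulN1r.
split=> [c|u v Du Dv|u v Du Dv|u Du].
- by rewrite -[ratK k c]mulr1 RZ R1 mulr0.
- by rewrite RD RN Du Dv subrr.
- by rewrite RM Du Dv mul0r mulr0 addr0.
have [->|u0] := eqVneq u 0; first by rewrite invr0 -{1}(subrr 1) RD RN subrr.
by apply: (mulfI u0); rewrite mulr0 -R1 -(divff u0) RM Du mul0r add0r.
Qed.

Lemma generative_adjoin phi z : generative phi z -> adjoin (ratK k) (eq z) phi.
Proof. by move=> [L [[[_ _ Lphi] _] Lg]]; apply/Lg. Qed.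

Lemma annihilator_generative phi z D :
  generative phi z -> annihilator z D -> annihilator phi D.
Proof.
move=> /generative_adjoin adj Dz; apply: (adj _ (W2_rat_ker_subfield D)).
by move=> _ <-.
Qed.

Lemma generative_nonconst phi z :
  ~ is_const phi -> generative phi z -> ~ is_const z.
Proof.
move=> nphi /generative_adjoin adj [c zc]; apply: nphi; apply: adj; last first.
  by move=> _ <-; exists c.
split=> [d|_ _ [a ->] [b ->]|_ _ [a ->] [b ->]|_ [a ->]].
- by exists d.
- by exists (a - b); rewrite rmorphB.
- by exists (a * b); rewrite rmorphM.
- by exists a^-1; rewrite fmorphV.
Qed.

(** The quotient rule, with the chain rule for the numerator and the
    denominator. *)
Lemma annihilator_quotient a b D : b != 0 ->
  annihilator (a%:F / b%:F) D <->
  D 'X_0 * (a^`M(0) * b - a * b^`M(0))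
    + D 'X_1 * (a^`M(1) * b - a * b^`M(1)) = 0.
Proof.
move=> b0; rewrite /annihilator W2_rat_quotient //.
have -> : D 'X_0 * (a^`M(0) * b - a * b^`M(0))
    + D 'X_1 * (a^`M(1) * b - a * b^`M(1)) = D a * b - a * D b.
  by rewrite [D a]W2_chain [D b]W2_chain; ring.
have bF : (b%:F ^+ 2)^-1 != 0 :> ratf k.
  by rewrite invr_eq0 expf_neq0 // tofrac_eq0.
split=> [/eqP|->]; last by rewrite tofrac0 mul0r.
by rewrite mulf_eq0 (negPf bF) orbF tofrac_eq0 => /eqP.
Qed.

Hypothesis char0 : [pchar k] =i pred0.

Lemma quotient_nonconst a b : b != 0 -> ~ is_const (a%:F / b%:F) ->
  a^`M(0) * b - a * b^`M(0) != 0 \/ a^`M(1) * b - a * b^`M(1) != 0.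
Proof.
move=> b0 nc; apply: contra_notP nc => /not_orP[/negP/negPn W0 /negP/negPn W1].
rewrite !subr_eq0 in W0 W1; have bF : b%:F != 0 :> ratf k by rewrite tofrac_eq0.
have [|c ->] := wronskian_eq0_proportional char0 b0 (a := a).
  move=> i; apply/eqP; by have [->|->] := ord2_eq i.
by exists c; rewrite -mul_mpolyC tofracM mulfK.
Qed.

End Derivations.

(** * Generators of the annihilator *)

Section Annihilator.
Variable k : closedFieldType.
Hypothesis char0 : [pchar k] =i pred0.
Implicit Types (D e delta : W2 k) (f g h : kxy k) (phi : ratf k).

Lemma annihilator_generator phi : ~ is_const phi ->
  exists e, [/\ e <> 0, annihilator phi e &
    forall D, annihilator phi D -> exists t, D = t *: e].
Proof.
have [a [b [b0 ->]]] := ratfP phi => /(quotient_nonconst char0 b0) nz.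
have annP D := annihilator_quotient a D b0.
set u := a^`M(0) * b - a * b^`M(0) in annP nz.
set v := a^`M(1) * b - a * b^`M(1) in annP nz.
have [f0 [g0 [syz gen]]] := kxy_syzygy_generator nz.
have gen_e D : annihilator (a%:F / b%:F) D -> exists t, D = t *: vfield f0 g0.
  move=> /annP /gen[t [ef eg]]; exists t.
  by apply: W2_eq; rewrite W2_ZE ?vfieldX0 ?vfieldX1.
exists (vfield f0 g0); split=> // [e0|]; last first.
  by apply/annP; rewrite vfieldX0 vfieldX1.
(* The obvious syzygy (v, -u) is nonzero and a multiple of the generator. *)
have [|t] := gen_e (vfield v (- u)).
  by apply/annP; rewrite vfieldX0 vfieldX1 mulNr mulrC subrr.
rewrite e0 scaler0 => W0; have v0 := vfieldX0 v (- u).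
have u0 := vfieldX1 v (- u).
rewrite W0 !W2_0E in v0 u0; case: nz => /eqP; apply=> //.
by apply/eqP; rewrite -oppr_eq0 -u0.
Qed.

(** Dividing any nonzero element of the annihilator by the gcd of its
    components gives a generator: the cofactor of that element with respect to
    a given generator is a common divisor of the components, hence divides
    the gcd. *)
Lemma primitive_free_generator phi h delta P Q : ~ is_const phi ->
  is_gcd P Q h -> h *: delta = vfield P Q -> annihilator phi (vfield P Q) ->
  vfield P Q <> 0 -> is_free_generator (annihilator phi) delta.
Proof.
move=> nc [_ _ h_max] eh annPQ PQ0.
have [e [e0 ann_e gen]] := annihilator_generator nc.
have h0 : h != 0 by apply: contra_not_neq PQ0 => h0; rewrite -eh h0 scale0r.
have delta0 : delta <> 0 by move=> d0; apply: PQ0; rewrite -eh d0 scaler0.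
have ann_delta : annihilator phi delta.
  move: annPQ; rewrite -eh; have [a [b [b0 ->]]] := ratfP phi.
  rewrite !annihilator_quotient // !W2_ZE -!mulrA -mulrDr => /eqP.
  by rewrite mulf_eq0 (negPf h0) => /eqP.
have [t et] := gen _ annPQ.
have [s es] : divides t h.
  apply: h_max; [exists (e 'X_0)|exists (e 'X_1)].
    by rewrite -[LHS](vfieldX0 P Q) et W2_ZE mulrC.
  by rewrite -[LHS](vfieldX1 P Q) et W2_ZE mulrC.
have t0 : t != 0 by apply: contraNneq h0 => t0; rewrite es t0 mulr0.
have es' : e = s *: delta.
  by apply: (W2_scalefI t0); rewrite scalerA mulrC -es eh et.
apply: W2_free_generator => // D /gen[r ->].
by exists (r * s); rewrite es' scalerA.
Qed.

Lemma is_gcd_oppC P Q h : is_gcd P Q h -> is_gcd (- Q) P h.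
Proof.
move=> [hP hQ h_max]; split=> //.
  by case: hQ => c ->; exists (- c); rewrite mulNr.
move=> d [c dQ] dP; apply: h_max => //.
by exists (- c); rewrite mulNr -dQ opprK.
Qed.

Lemma delta_free_generator phi delta : ~ is_const phi ->
  is_delta phi delta -> is_free_generator (annihilator phi) delta.
Proof.
move=> nc [[p [_ gen [h gcd eh]]]|[_ [p [q [_ [q0 _ _] _ gen [h gcd eh]]]]]].
  (* A polynomial p is treated as the quotient p / 1. *)
  have := generative_nonconst nc gen; rewrite -[p%:F]divr1 -(tofrac1 (kxy k)).
  move/(quotient_nonconst char0 (oner_neq0 _)).
  have d1 i : (1 : kxy k)^`M(i) = 0 by rewrite -mpolyC1 mderivC.
  rewrite !d1 !mulr1 !mulr0 !subr0 => nz.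
  apply: (primitive_free_generator nc (is_gcd_oppC gcd) eh).
    apply: (annihilator_generative gen).
    by rewrite /annihilator W2_rat_tofrac vfieldE mulNr mulrC addNr tofrac0.
  move=> W0; have := vfieldX0 (- p^`M(1)) p^`M(0).
  have := vfieldX1 (- p^`M(1)) p^`M(0).
  rewrite W0 !W2_0E => e0 /esym/eqP; rewrite oppr_eq0 => e1.
  by case: nz => /eqP; apply; [rewrite -e0|apply/eqP].
have nz := quotient_nonconst char0 q0 (generative_nonconst nc gen).
apply: (primitive_free_generator nc gcd eh).
  apply: (annihilator_generative gen); apply/annihilator_quotient => //.
  by rewrite vfieldX0 vfieldX1; ring.
set P := p * _ - _; set Q := q * _ - _ => W0.
have eP := vfieldX0 P Q; have eQ := vfieldX1 P Q; rewrite W0 !W2_0E in eP eQ.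
have WQ : p^`M(0) * q - p * q^`M(0) = Q by rewrite /Q; ring.
have WP : p^`M(1) * q - p * q^`M(1) = - P by rewrite /P; ring.
by case: nz; rewrite ?WQ ?WP -?eQ -?eP ?oppr0 eqxx.
Qed.

End Annihilator.

Theorem theorem6 (k : closedFieldType) (char0 : [pchar k] =i pred0)
    (phi : ratf k) (phi_nonconst : ~ is_const phi) :
  [/\ is_submodule (annihilator phi),
      is_free_of_rank (annihilator phi) 1 &
      forall delta : W2 k,
        is_delta phi delta -> is_free_generator (annihilator phi) delta].
Proof.
split; first exact: annihilator_submodule.
  have [e [e0 ann_e gen]] := annihilator_generator char0 phi_nonconst.
  by exists (fun=> e); apply: W2_free_generator.
by move=> delta; apply: delta_free_generator.
Qed.
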